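(* Let $n$ be a positive integer. The number of weakly $\mathbb{Z}_2^n$-equivariant homeomorphism classes of small covers over the $n$-cube $I^n$ is less than or equal to the number of acyclic digraphs with $n$ unlabeled nodes.
   Context: $\mathbb{Z}_2$ denotes the group (field) with two elements. Digraphs: a digraph on $n$ nodes has at most one edge directed from vertex $i$ to vertex $j$, for each ordered pair of vertices $(i,j)$. It is acyclic if it has no directed cycle of any length (in particular no loops and no directed 2-cycles). Acyclic digraphs with $n$ unlabeled nodes are isomorphism classes of acyclic digraphs on $n$ nodes, i.e. acyclic digraphs up to relabeling of the nodes. Small covers: let $P$ be a simple convex polytope of dimension $n$ (here $P=I^n$). The standard action of $\mathbb{Z}_2^n$ on $\mathbb{R}^n$ is by sign changes of the coordinates; a $\mathbb{Z}_2^n$-action on an $n$-manifold is locally standard if it is locally isomorphic, up to an automorphism of $\mathbb{Z}_2^n$, to the standard action. A small cover over $P$ is a smooth closed manifold $M$ of dimension $n$ with a locally standard $\mathbb{Z}_2^n$-action whose orbit space is $P$ (identified as a manifold with corners). Weak equivariant homeomorphism: two small covers $M_1,M_2$ are weakly $\mathbb{Z}_2^n$-equivariantly homeomorphic if there are an automorphism $\varphi:\mathbb{Z}_2^n\to\mathbb{Z}_2^n$ and a homeomorphism $f:M_1\to M_2$ such that $f(t\cdot x)=\varphi(t)\cdot f(x)$ for every $t\in\mathbb{Z}_2^n$ and $x\in M_1$ (the induced map on orbit spaces need not be the identity). *)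

(* Defs.v *)
From HB Require Import structures.
From mathcomp Require Import all_boot all_order all_algebra all_fingroup.
From mathcomp Require Import all_classical all_reals all_analysis.

Set Implicit Arguments.
Unset Strict Implicit.
Unset Printing Implicit Defensive.

Import Order.TTheory GRing.Theory Num.Theory.
Import numFieldNormedType.Exports.

Local Open Scope ring_scope.

Section Digraphs.
Variable n : nat.

(* The set of edges: (i, j) is the edge directed from i to j. *)
Definition digraph := {set 'I_n * 'I_n}.

Definition edge (E : digraph) : rel 'I_n := fun i j => (i, j) \in E.

(* [cycle e [:: i]] means [e i i], so loops are directed cycles. *)
Definition acyclic (E : digraph) : Prop :=
  forall c : seq 'I_n, ucycle (edge E) c -> c = [::].

Definition relabel (s : 'S_n) (E : digraph) : digraph :=
  [set (s p.1, s p.2) | p in E]%SET.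

Definition digraph_iso : rel digraph :=
  fun E F => [exists s : 'S_n, relabel s E == F].

Definition num_unlabeled_acyclic_digraphs : nat :=
  #|equivalence_partition digraph_iso [set E : digraph | `[< acyclic E >]]%SET|.

End Digraphs.

(* The equivalence relation r has exactly N classes: c identifies the quotient
   of T by r with 'I_N. The universe of [set] is too small for the type of all
   small covers, so that the cardinals of the library do not apply to their
   classes. *)
Definition has_num_classes (T : Type) (r : T -> T -> Prop) (N : nat) : Prop :=
  exists c : T -> 'I_N,
    (forall i, exists x, c x = i) /\ (forall x y, c x = c y <-> r x y).

(* The elementary 2-group, the additive group of the row space over F_2; its
   finGroupType structure is the one of the library, with [+%R] as the law. *)
Definition Z2n (n : nat) : finGroupType := 'rV['F_2]_n.

Definition is_Z2n_aut n (phi : {perm Z2n n}) : Prop :=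
  phi \in Aut [set: Z2n n]%SET.

Local Open Scope classical_set_scope.

Section SmallCovers.
Variables (R : realType) (n : nat).

Local Notation Rn := 'rV[R]_n.

Definition sign_act (v : Rn) (t : Z2n n) : Rn :=
  \row_i ((-1) ^+ (t : 'rV['F_2]_n) 0 i * v 0 i).

Fixpoint Ck (k : nat) (D : set Rn) (h : Rn -> Rn) : Prop :=
  (forall x, D x -> {for x, continuous h}) /\
  (if k is k'.+1 then
     forall v, (forall x, D x -> derivable h x v) /\ Ck k' D ('D_v h)
   else True).

Definition smooth_on (D : set Rn) (h : Rn -> Rn) : Prop :=
  forall k, Ck k D h.

(* On U, the map g is a smooth function of f; when f is injective on U this
   says that g \o f^-1 : f(U) -> R^n is smooth. *)
Definition smooth_in_terms_of (T : Type) (U : set T) (f g : T -> Rn) : Prop :=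
  exists2 h : Rn -> Rn,
    smooth_on (f @` U) h & forall x, U x -> h (f x) = g x.

(* A chart c consists of its domain c.1 and of a map c.2, whose values outside
   of c.1 are irrelevant. *)
Definition chart_on (M : topologicalType) : Type := set M * (M -> Rn).

(* c.2 is a homeomorphism from the open set c.1 onto an open subset of R^n. *)
Definition is_chart (M : topologicalType) (c : chart_on M) : Prop :=
  [/\ open c.1,
      (forall x, c.1 x -> {for x, continuous c.2}),
      (forall x y, c.1 x -> c.1 y -> c.2 x = c.2 y -> x = y) &
      (forall W : set M, open W -> W `<=` c.1 -> open (c.2 @` W))].

Definition is_smooth_atlas (M : topologicalType) (A : set (chart_on M)) : Prop :=
  [/\ (forall c, A c -> is_chart c),
      (forall x, exists2 c, A c & c.1 x) &
      (forall c d, A c -> A d -> smooth_in_terms_of (c.1 `&` d.1) c.2 d.2)].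

(* c belongs to the maximal smooth atlas generated by A. *)
Definition is_smooth_chart (M : topologicalType) (A : set (chart_on M))
    (c : chart_on M) : Prop :=
  is_chart c /\
  forall d, A d -> smooth_in_terms_of (c.1 `&` d.1) c.2 d.2 /\
                   smooth_in_terms_of (c.1 `&` d.1) d.2 c.2.

(* Compactness and the finite-dimensional charts imply second countability. *)
Definition is_smooth_closed_manifold (M : topologicalType)
    (A : set (chart_on M)) : Prop :=
  [/\ hausdorff_space M, compact [set: M] & is_smooth_atlas A].

Definition is_smooth_action (M : topologicalType) (A : set (chart_on M))
    (to : {action Z2n n &-> M}) : Prop :=
  forall t : Z2n n, continuous (fun x => to x t) /\
    forall c d, A c -> A d ->
      smooth_in_terms_of (c.1 `&` [set x | d.1 (to x t)]) c.2
                         (fun x => d.2 (to x t)).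

(* A chart that identifies the action on the invariant open set c.1 with the
   standard action on c.2(c.1), up to an automorphism of the group. *)
Definition is_standard_chart (M : topologicalType) (A : set (chart_on M))
    (to : {action Z2n n &-> M}) (c : chart_on M) : Prop :=
  [/\ is_smooth_chart A c,
      (forall x t, c.1 x -> c.1 (to x t)) &
      exists2 phi : {perm Z2n n}, is_Z2n_aut phi &
        forall x t, c.1 x -> c.2 (to x t) = sign_act (c.2 x) (phi t)].

Definition is_locally_standard (M : topologicalType) (A : set (chart_on M))
    (to : {action Z2n n &-> M}) : Prop :=
  forall x, exists2 c, is_standard_chart A to c & c.1 x.

Definition cube : set Rn := [set v | forall i, 0 <= v 0 i <= 1].

(* The codimension of the face of the cube whose relative interior contains
   v. *)
Definition cube_codim (v : Rn) : nat :=
  #|[pred i | (v 0 i == 0) || (v 0 i == 1)]|.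

(* The codimension of the orbit of v in the orbit space of the standard action,
   the corner {w | forall i, 0 <= w_i}. *)
Definition corner_codim (v : Rn) : nat := #|[pred i | v 0 i == 0]|.

(* p induces a homeomorphism from the orbit space, with the quotient topology,
   onto the cube, which is an isomorphism of manifolds with corners: it
   preserves the stratification by codimension. The corner structure of the
   orbit space is the one induced by the standard charts. *)
Definition is_orbit_map (M : topologicalType) (A : set (chart_on M))
    (to : {action Z2n n &-> M}) (p : M -> Rn) : Prop :=
  [/\ range p = cube,
      (forall x y, p x = p y <-> exists t, to x t = y),
      continuous p,
      (forall B : set Rn, open (p @^-1` B) ->
         exists2 O, open O & O `&` cube = B `&` cube) &
      (forall c x, is_standard_chart A to c -> c.1 x ->
         cube_codim (p x) = corner_codim (c.2 x))].

Record small_cover_over_cube := SmallCoverOverCube {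
  sc_space :> topologicalType;
  sc_atlas : set (chart_on sc_space);
  sc_action : {action Z2n n &-> sc_space};
  sc_orbit_map : sc_space -> Rn;
  sc_manifold : is_smooth_closed_manifold sc_atlas;
  sc_smooth : is_smooth_action sc_atlas sc_action;
  sc_locally_standard : is_locally_standard sc_atlas sc_action;
  sc_orbit_space : is_orbit_map sc_atlas sc_action sc_orbit_map
}.

Definition weakly_equiv_homeo (M1 M2 : small_cover_over_cube) : Prop :=
  exists (phi : {perm Z2n n}) (f : M1 -> M2) (g : M2 -> M1),
    [/\ is_Z2n_aut phi,
        [/\ continuous f, continuous g, cancel f g & cancel g f] &
        forall x t, f (sc_action M1 x t) = sc_action M2 (f x) (phi t)].

End SmallCovers.

(* Main.v *)
Require Import Defs.
From mathcomp Require Import all_boot all_order all_algebra all_fingroup.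
From mathcomp Require Import all_classical all_reals all_analysis.
From mathcomp Require Import ring lra.

(** The classes are counted by an invariant: to every small cover of the cube
    is attached an acyclic digraph on the coordinates, in such a way that
    covers with isomorphic digraphs are weakly equivariantly homeomorphic.
    There are then at most as many classes as unlabeled acyclic digraphs
    ([has_num_classes_le]).

    The digraph comes from the characteristic function of the cover. All the
    points over the relative interior of the facet x_i = e of the cube, with e
    in {0, 1}, have the same isotropy group, which has order 2; let lam i e be
    its generator. The isotropy group of an arbitrary point is spanned by the
    vectors of the facets that contain its image
    ([exists_characteristic_function]). Over a vertex it is the whole group,
    so the n facets through a vertex give a basis of F_2^n. Let A be the matrix
    of the vectors lam i 1 in the basis of the vectors lam i 0. The condition
    at the vertices says that all the principal minors of A are 1
    ([mixed_unit]), and this makes A the sum of the identity and of the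
    adjacency matrix of an acyclic digraph: a minimal nonempty set of nodes in
    which every node has a successor is a directed cycle without chords, and
    the rows of A that it indexes add up to zero in the columns that it
    indexes, which contradicts the invertibility of A on it
    ([digraph_of_sink]).

    Conversely the digraph determines the cover. The orbit map has a section
    over the whole cube ([exists_section]). Locally, the points with
    nonnegative coordinates in a standard chart meet each orbit once. Two
    sections over boxes with a common face differ on that face by a single
    element of the group, because the action is free over the interior of the
    cube; so they can be glued, and the cube is cut into boxes so small that
    they have sections. With a section, a cover is the quotient of the product
    of the cube and the group by the isotropy groups. An isomorphism of
    digraphs is a permutation of the coordinates of the cube; together with the
    automorphism of F_2^n that it induces it carries one characteristic
    function to the other, hence one quotient to the other
    ([weakly_equiv_of_digraph_iso]). *)

Set Implicit Arguments.
Unset Strict Implicit.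
Unset Printing Implicit Defensive.

Import Order.TTheory GRing.Theory Num.Theory.
Import numFieldNormedType.Exports.

Local Open Scope classical_set_scope.
Local Open Scope ring_scope.

(** * Counting classes with an invariant *)

(** A class of [r] is encoded by the finite set of the values that [F] takes on
    it. The values of [F] need not be constant on a class, but they determine
    the class, so there are at most #|P| classes. *)
Lemma has_num_classes_le (T : Type) (r : T -> T -> Prop) (U : finType)
    (P : {set U}) (F : T -> U) :
  (forall x, r x x) -> (forall x y, r x y -> r y x) ->
  (forall x y z, r x y -> r y z -> r x z) ->
  (forall x, F x \in P) -> (forall x y, F x = F y -> r x y) ->
  exists2 N : nat, has_num_classes r N & (N <= #|P|)%N.
Proof.
move=> rr rs rt FP Fr.
pose e u := [set v : U | `[< exists x y, [/\ F x = u, F y = v & r x y] >]]%SET.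
pose S := [set A : {set U} | `[< exists x, e (F x) = A >]]%SET.
have eS x : e (F x) \in S by rewrite inE; apply/asboolP; exists x.
exists #|S|; last first.
  apply: leq_trans (leq_imset_card e P); apply: subset_leq_card.
  by apply/fintype.subsetP => A; rewrite inE => /asboolP[x <-]; exact: imset_f.
exists (fun x => enum_rank_in (eS x) (e (F x))); split=> [i|x y].
  have := enum_valP i; rewrite inE => /asboolP[x ex].
  by exists x; apply: enum_val_inj; rewrite enum_rankK_in.
split=> [exy|rxy]; last first.
  apply: enum_val_inj; rewrite !enum_rankK_in//.
  apply/setP => v; rewrite !inE; apply/asboolP/asboolP;
    move=> -[x' [y' [xx' <- r']]].
    by exists y, y'; split=> //;
      exact: (rt _ _ _ (rt _ _ _ (rs _ _ rxy) (Fr _ _ (esym xx'))) r').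
  by exists x, y'; split=> //;
    exact: (rt _ _ _ (rt _ _ _ rxy (Fr _ _ (esym xx'))) r').
have {exy} exy : e (F x) = e (F y).
  by rewrite -[LHS](enum_rankK_in (eS x))// exy enum_rankK_in.
have : F y \in e (F y) by rewrite inE; apply/asboolP; exists y, y.
rewrite -exy inE => /asboolP[x' [y' [x'x y'y r']]].
exact: (rt _ _ _ (rt _ _ _ (Fr _ _ (esym x'x)) r') (Fr _ _ y'y)).
Qed.

(** * Continuity, boxes and segments in Euclidean space *)

Lemma continuous_rV_at (T : topologicalType) (R : realType) n
    (f : T -> 'rV[R]_n) (x : T) :
  (forall i, (fun y => f y 0 i) @ x --> f x 0 i) -> f @ x --> f x.
Proof.
move=> fc A [P fP PA].
have : \forall y \near x, forall i, P 0 i (f y 0 i).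
  by apply: filter_forall => i; apply: fc; exact: fP.
by apply: filterS => y Py; apply: PA => i j; rewrite (ord1 i).
Qed.

Lemma comp_continuous (X Y Z : topologicalType) (f : X -> Y) (g : Y -> Z) :
  continuous f -> continuous g -> continuous (g \o f).
Proof. by move=> fc gc x; apply: continuous_comp; [exact: fc|exact: gc]. Qed.

Lemma continuous_glue (X Y : topologicalType) (R : realType) (f g : X -> Y)
    (h : X -> R) (c : R) :
  continuous f -> continuous g -> continuous h ->
  (forall x, h x = c -> f x = g x) ->
  continuous (fun x => if h x <= c then f x else g x).
Proof.
move=> /continuous_closedP fc /continuous_closedP gc hc fg.
have hle : closed (h @^-1` [set r | r <= c]).
  by apply: closed_comp (@closed_le _ c) => r _; exact: hc.
have hge : closed (h @^-1` [set r | c <= r]).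
  by apply: closed_comp (@closed_ge _ c) => r _; exact: hc.
apply/continuous_closedP => C Ccl.
rewrite (_ : _ @^-1` _ = (h @^-1` [set r | r <= c] `&` f @^-1` C) `|`
                         (h @^-1` [set r | c <= r] `&` g @^-1` C)).
  by apply: closedU; apply: closedI => //; [exact: fc|exact: gc].
rewrite predeqE => x /=; case: ltgtP => hx; split.
- by left.
- by case=> -[].
- by right.
- by case=> -[].
- by left.
- by case=> -[_] //; rewrite fg.
Qed.

Lemma coord_cvg (R : realType) n (v : 'rV[R]_n) i :
  (fun w : 'rV[R]_n => w 0 i) @ v --> v 0 i.
Proof. exact: coord_continuous. Qed.

Definition clamp (R : realType) n (a b v : 'rV[R]_n) : 'rV[R]_n :=
  \row_i Num.max (a 0 i) (Num.min (b 0 i) (v 0 i)).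

Definition box (R : realType) n (a b : 'rV[R]_n) : set 'rV[R]_n :=
  [set v | forall i, a 0 i <= v 0 i <= b 0 i].

Lemma continuous_clamp (R : realType) n (a b : 'rV[R]_n) :
  continuous (clamp a b).
Proof.
move=> v; apply: continuous_rV_at => i.
pose g := cst (a 0 i) \max (cst (b 0 i) \min (fun w : 'rV[R]_n => w 0 i)).
have -> : (fun y => clamp a b y 0 i) = g by apply/funext => w; rewrite mxE.
have -> : clamp a b v 0 i = g v by rewrite mxE.
apply: (@continuous_max R _ (cst (a 0 i)) _ v); first exact: cst_continuous.
by apply: (@continuous_min R _ (cst (b 0 i)) _ v);
  [exact: cst_continuous|exact: coord_cvg].
Qed.

Lemma clamp_box (R : realType) n (a b v : 'rV[R]_n) :
  (forall i, a 0 i <= b 0 i) -> box a b (clamp a b v).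
Proof.
by move=> ab i; rewrite mxE le_max lexx/= ge_max ab ge_min lexx.
Qed.

Lemma clamp_id (R : realType) n (a b v : 'rV[R]_n) :
  box a b v -> clamp a b v = v.
Proof.
move=> vab; apply/rowP => i; rewrite mxE; have /andP[av vb] := vab i.
by rewrite min_r// max_r.
Qed.

Lemma closed_eq_continuous (T U : topologicalType) (f g : T -> U) :
  hausdorff_space U -> continuous f -> continuous g ->
  closed [set x | f x = g x].
Proof.
rewrite open_hausdorff => hU fc gc.
rewrite -openC openE => x /= /eqP fgx.
have [[A B]/= [fA gB] [oA oB AB]] := hU _ _ fgx.
have nA : nbhs x (f @^-1` A) := fc x A (open_nbhs_nbhs (conj oA (set_mem fA))).
have nB : nbhs x (g @^-1` B) := gc x B (open_nbhs_nbhs (conj oB (set_mem gB))).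
rewrite /interior/=; apply: filterS (filterI nA nB) => y [/= Ay By] /= fgy.
by have : set0 (f y) by rewrite -(eqP AB); split=> //; rewrite fgy.
Qed.

Definition segm (R : realType) n (v w : 'rV[R]_n) (r : R) : 'rV[R]_n :=
  v + r *: (w - v).

Lemma continuous_segm (R : realType) n (v w : 'rV[R]_n) :
  continuous (segm v w).
Proof.
move=> r; apply: continuous_rV_at => i.
have -> : (fun r => segm v w r 0 i) = (fun r => v 0 i + r * (w 0 i - v 0 i)).
  by apply/funext => q; rewrite !mxE.
rewrite /segm !mxE; apply: cvgD; first exact: cvg_cst.
by apply: cvgM; [exact: cvg_id|exact: cvg_cst].
Qed.

(** The parameters in [0, 1) are partitioned by the closed sets [E u], which are
    finite in number, hence also open; since the interval is connected a single
    one of them occurs, and it contains the end point as well. The uniqueness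
    may fail at [w]: this is how a property that holds over the interior of a
    face is carried to its boundary. *)
Lemma closed_partition_segm (R : realType) n (T : finType)
    (E : T -> set 'rV[R]_n) (v w : 'rV[R]_n) (t : T) :
  (forall u, closed (E u)) ->
  (forall r, 0 <= r < 1 -> exists u, E u (segm v w r)) ->
  (forall r u u', 0 <= r < 1 -> E u (segm v w r) -> E u' (segm v w r) ->
    u = u') ->
  E t v -> E t w.
Proof.
move=> Ecl Eex Euniq Etv.
pose G u := segm v w @^-1` E u.
have Gcl u : closed (G u).
  by apply: closed_comp (Ecl u) => r _; exact: continuous_segm.
pose I := `[0 : R, 1[%classic.
have itvE r : I r = (0 <= r < 1) by rewrite /I/= in_itv.
have Gt : I `&` G t = I.
  have : connected I by apply/connected_intervalP/interval_is_interval.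
  apply.
  - by exists 0; split; rewrite ?itvE ?lexx ?ltr01// /G/= /segm scale0r addr0.
  - exists (~` \bigcup_(u in [set u | u != t]) G u).
      by rewrite openC; apply: closed_bigcup => //; exact: finite_finset.
    rewrite predeqE => r; split=> -[r01 Gr]; split => //.
      by move=> [u /= /eqP ut Gu]; apply: ut; apply: Euniq Gu Gr; rewrite -itvE.
    have [|u Gu] := Eex r; first by rewrite -itvE.
    by have [<-//|ut] := eqVneq u t; exfalso; apply: Gr; exists u.
  - by exists (G t).
have G1 : G t 1.
  apply: contrapT => nG.
  have : nbhs (1 : R) (~` G t).
    by apply: open_nbhs_nbhs; split=> //; rewrite openC.
  move=> /nbhs_ballP[e /= e0]; apply/existsNP; exists (Num.max 0 (1 - e / 2)).
  apply/not_implyP; split.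
    case: (ltP 0 (1 - e / 2)) => [_|]; rewrite /ball/=.
      by rewrite opprB addrC subrK gtr0_norm; lra.
    by rewrite subr0 normr1; lra.
  move=> nGr; apply: nGr.
  have : I (Num.max 0 (1 - e / 2)).
    by rewrite itvE le_max lexx/= gt_max ltr01/=; lra.
  by rewrite -Gt => -[].
by move: G1; rewrite /G/= /segm scale1r addrC subrK.
Qed.

(** * Elementary 2-groups and sign changes *)

Lemma F2_cases (b : 'F_2) : b = 0 \/ b = 1.
Proof. by case: b => -[|[|//]] H; [left|right]; apply: val_inj. Qed.

Lemma F2_addrr (b : 'F_2) : b + b = 0.
Proof. by case: (F2_cases b) => ->; apply: val_inj. Qed.

Lemma F2_addvv n (v : 'rV['F_2]_n) : v + v = 0.
Proof. by apply/rowP => i; rewrite !mxE F2_addrr. Qed.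

Lemma Z2n_autP n (phi : {perm Z2n n}) :
  is_Z2n_aut phi <->
  forall s t : 'rV['F_2]_n, phi (s + t) = phi s + phi t :> 'rV['F_2]_n.
Proof.
rewrite /is_Z2n_aut inE; split=> [/andP[_ /morphicP phiM] s t|phiD].
  by apply: phiM; rewrite inE.
apply/andP; split; first by apply/fintype.subsetP => x; rewrite inE.
by apply/morphicP => s t _ _; exact: phiD.
Qed.

Lemma aut0 n (phi : {perm Z2n n}) :
  is_Z2n_aut phi -> phi (0 : 'rV_n) = 0 :> 'rV_n.
Proof.
move=> /Z2n_autP /(_ 0 0); rewrite addr0 => /esym/eqP.
by rewrite -subr_eq0 addrK => /eqP.
Qed.

Lemma autV n (phi : {perm Z2n n}) : is_Z2n_aut phi -> is_Z2n_aut phi^-1%g.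
Proof. by rewrite /is_Z2n_aut groupV. Qed.

Lemma aut_sum n (phi : {perm Z2n n}) m (a : 'I_m -> 'F_2)
    (e : 'I_m -> 'rV['F_2]_n) : is_Z2n_aut phi ->
  phi (\sum_i a i *: e i) = \sum_i a i *: (phi (e i) : 'rV_n) :> 'rV_n.
Proof.
move=> phia; have phiD := (Z2n_autP phi).1 phia.
rewrite (big_morph (phi : 'rV_n -> 'rV_n) phiD (aut0 phia)).
apply: eq_bigr => i _; case: (F2_cases (a i)) => ->.
  by rewrite !scale0r aut0.
by rewrite !scale1r.
Qed.

Section Sign.
Variables (R : realType) (n : nat).
Implicit Types (v : 'rV[R]_n) (t : Z2n n).

Lemma sign_act_fix v t :
  sign_act v t = v <->
  forall i, v 0 i != 0 -> (t : 'rV['F_2]_n) 0 i = 0.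
Proof.
split=> [/rowP vt i vi|t0].
  have := vt i; rewrite mxE.
  case: (F2_cases ((t : 'rV_n) 0 i)) => -> //=; rewrite expr1 => /eqP.
  by rewrite mulN1r eqNr (negPf vi).
apply/rowP => i; rewrite mxE; have [->|vi] := eqVneq (v 0 i) 0.
  by rewrite mulr0.
by rewrite t0 //= expr0 mul1r.
Qed.

Definition sign_of v : Z2n n := \row_i (if v 0 i < 0 then 1 else 0 : 'F_2).

(** The representative of the orbit of [v] under sign changes in the corner
    of the vectors with nonnegative coordinates. *)
Definition absv v : 'rV[R]_n := \row_i `|v 0 i|.

Lemma sign_act_sign_of v : sign_act v (sign_of v) = absv v.
Proof.
apply/rowP => i; rewrite !mxE; case: ltP => vi /=.
  by rewrite expr1 mulN1r ltr0_norm.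
by rewrite expr0 mul1r ger0_norm.
Qed.

Lemma absv_sign_act v t : absv (sign_act v t) = absv v.
Proof. by apply/rowP => i; rewrite !mxE normrM normrX normrN1 expr1n mul1r. Qed.

Lemma absv_absv v : absv (absv v) = absv v.
Proof. by apply/rowP => i; rewrite !mxE normr_id. Qed.

Lemma absv_cvg v : absv @ v --> absv v.
Proof.
apply: continuous_rV_at => i.
have -> : (fun w => absv w 0 i) = (fun w : 'rV[R]_n => `|w 0 i|).
  by apply/funext => w; rewrite mxE.
rewrite mxE; apply: (cvg_comp _ _ (@coord_cvg R n v i)).
exact: (@norm_continuous _ R^o).
Qed.

End Sign.

(** * Local sections of the orbit map *)

Lemma total_actM (aT : finGroupType) (rT : Type) (a : {action aT &-> rT})
    x s t :
  a x (s * t)%g = a (a x s) t.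
Proof. by case: a => a [_ aM] /=; apply: aM; rewrite inE. Qed.

Lemma total_act1 (aT : finGroupType) (rT : Type) (a : {action aT &-> rT}) x :
  a x 1%g = x.
Proof.
by have /= := total_actM a x 1%g 1%g; rewrite mulg1; case: a => a [ai _] /= /ai.
Qed.

Section LocalStructure.
Variables (R : realType) (n : nat) (M : small_cover_over_cube R n).
Local Notation Rn := 'rV[R]_n.
Local Notation to := (sc_action M).
Local Notation p := (@sc_orbit_map R n M).
Implicit Types (x y : M) (s t : Z2n n).

Lemma sc_hausdorff : hausdorff_space M.
Proof. by case: (sc_manifold M). Qed.

Lemma sc_compact : compact [set: M].
Proof. by case: (sc_manifold M). Qed.

Lemma action_continuous t : continuous (to^~ t).
Proof. by case: (sc_smooth M t). Qed.

Lemma orbit_map_continuous : continuous p.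
Proof. by case: (sc_orbit_space M). Qed.

Lemma orbit_mapP x y : p x = p y <-> exists t, to x t = y.
Proof. by case: (sc_orbit_space M). Qed.

Lemma orbit_map_act x t : p (to x t) = p x.
Proof. by apply/esym/orbit_mapP; exists t. Qed.

Lemma cube_orbit_map x : cube (p x).
Proof. by have [<- _ _ _ _] := sc_orbit_space M; exists x. Qed.

Lemma orbit_map_surj v : cube v -> exists x, p x = v.
Proof. by have [<- _ _ _ _] := sc_orbit_space M; case=> x _ <-; exists x. Qed.

Lemma orbit_map_quotient (B : set Rn) : open (p @^-1` B) ->
  exists2 O, open O & O `&` @cube R n = B `&` @cube R n.
Proof. by have [_ _ _ + _] := sc_orbit_space M; apply. Qed.

Lemma actD x s t : to x ((s : 'rV_n) + t) = to (to x s) t.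
Proof. exact: total_actM. Qed.

Lemma act0 x : to x (0 : 'rV_n) = x.
Proof. exact: total_act1. Qed.

Lemma actK_F2 x t : to (to x t) t = x.
Proof. by rewrite -actD F2_addvv act0. Qed.

(** The topological content of a standard chart [c], with its twist [phi] made
    explicit. *)
Record standard_coordinates (c : chart_on R n M) (phi : {perm Z2n n}) : Prop :=
{
  coord_open : open c.1;
  coord_continuous_at : forall x, c.1 x -> c.2 @ x --> c.2 x;
  coord_inj : forall x y, c.1 x -> c.1 y -> c.2 x = c.2 y -> x = y;
  coord_open_map : forall W : set M, open W -> W `<=` c.1 -> open (c.2 @` W);
  coord_stable : forall x t, c.1 x -> c.1 (to x t);
  coord_aut : is_Z2n_aut phi;
  coord_act : forall x t, c.1 x -> c.2 (to x t) = sign_act (c.2 x) (phi t);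
  coord_codim : forall x, c.1 x -> cube_codim (p x) = corner_codim (c.2 x)
}.

Lemma standard_coordinates_at x :
  exists c phi, standard_coordinates c phi /\ c.1 x.
Proof.
have [c cstd cx] := @sc_locally_standard R n M x.
have [[[co cc ci cm] _] cs [phi aphi cphi]] := cstd.
exists c, phi; split=> //; split=> // y cy.
by have [_ _ _ _] := sc_orbit_space M; apply.
Qed.

Lemma coord_stab c phi x t : standard_coordinates c phi -> c.1 x ->
  to x t = x <-> forall i, c.2 x 0 i != 0 -> (phi t : 'rV_n) 0 i = 0.
Proof.
move=> cphi cx; rewrite -sign_act_fix -(coord_act cphi)//.
split=> [->//|]; apply: (coord_inj cphi) => //; exact: (coord_stable cphi).
Qed.

(** In standard coordinates the section takes [w] to the only point over [w]
    whose coordinates are nonnegative. It is continuous because the points of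
    an invariant open set have an open image in the cube. Continuity is stated
    relatively to the cube, as the values of [s] elsewhere are arbitrary. *)
Lemma local_section v : cube v ->
  exists (O : set Rn) (s : Rn -> M), [/\ open O, O v,
    forall w, O w -> cube w -> p (s w) = w &
    forall (W : set M) w, open W -> O w -> cube w -> W (s w) ->
      exists O', [/\ open O', O' w & forall w', O' w' -> cube w' -> W (s w')]].
Proof.
move=> /orbit_map_surj[x0 px0].
have [c [phi [cphi cx0]]] := standard_coordinates_at x0.
pose good w y := [/\ c.1 y, p y = w & absv (c.2 y) = c.2 y].
have good_uniq w y z : good w y -> good w z -> y = z.
  move=> [cy py ay] [cz pz az]; apply: (coord_inj cphi) => //.
  move: py; rewrite -pz => /orbit_mapP[t yt].
  by rewrite -ay -az -yt (coord_act cphi)// absv_sign_act.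
have good_ex y : c.1 y -> exists z, good (p y) z /\ c.2 z = absv (c.2 y).
  move=> cy; pose t := (phi^-1)%g (sign_of (c.2 y)).
  have cty : c.2 (to y t) = absv (c.2 y).
    by rewrite (coord_act cphi)// permKV sign_act_sign_of.
  exists (to y t); split=> //; split; rewrite ?orbit_map_act//.
    exact: (coord_stable cphi).
  by rewrite cty absv_absv.
pose s w := xget x0 (good w).
have sP w y : good w y -> s w = y.
  by move=> gy; exact: (good_uniq w _ _ (xgetPex x0 (ex_intro _ y gy)) gy).
(* The image of an invariant open set is open in the cube, because it has that
   set as its preimage. *)
have sat (U : set M) :
    open U -> U `<=` c.1 -> (forall y t, U y -> U (to y t)) ->
    exists2 O, open O & forall w, cube w -> O w <-> exists2 y, U y & p y = w.
  move=> oU Uc Ut; have [|O oO OU] := @orbit_map_quotient (p @` U).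
    rewrite (_ : _ @^-1` _ = U)//.
    rewrite predeqE => y; split; last by exists y.
    by move=> [z Uz /orbit_mapP[t <-]]; exact: Ut.
  exists O => // w cw; split=> [Ow|[y Uy pw]].
    by have : (O `&` @cube R n) w by []; rewrite OU => -[[y Uy <-] _]; exists y.
  have : (p @` U `&` @cube R n) w by split=> //; exists y.
  by rewrite -OU => -[].
have [B oB BP] := sat c.1 (coord_open cphi) (fun _ => id) (coord_stable cphi).
exists B, s; split=> // [|w Bw cw|W w oW Bw cw Ws].
- by apply/BP; [rewrite -px0; exact: cube_orbit_map|exists x0].
- have [y cy <-] := (BP w cw).1 Bw.
  by have [z [gz _]] := good_ex y cy; rewrite (sP _ z gz); case: gz.
pose V := c.2 @` (W `&` c.1).
have oV : open V.
  apply: (coord_open_map cphi); last by move=> ? [].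
  exact: openI oW (coord_open cphi).
pose U := [set y | c.1 y /\ V (absv (c.2 y))].
have oU : open U.
  rewrite openE => y [cy Vy]; rewrite /interior/=.
  apply: filterI; first exact: (open_nbhs_nbhs (conj (coord_open cphi) cy)).
  have : (@absv R n \o c.2) @ y --> absv (c.2 y).
    by apply: cvg_comp; [exact: (coord_continuous_at cphi)|exact: absv_cvg].
  by apply; exact: open_nbhs_nbhs.
have [|y t [cy Vy]|O' oO' O'P] := sat U oU; first by move=> ? [].
  split; first exact: (coord_stable cphi).
  by rewrite (coord_act cphi)// absv_sign_act.
exists O'; split=> // [|w' Ow' cw'].
  apply/O'P => //; have [y cy yw] := (BP w cw).1 Bw; rewrite -yw in Ws *.
  have [z [gz _]] := good_ex y cy; have sz := sP _ _ gz.
  have [cz pz az] := gz; exists z => //; split=> //; rewrite az.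
  by exists z => //; split=> //; rewrite -sz.
have [y [cy [z [Wz cz] czy]] <-] := (O'P w' cw').1 Ow'.
have [z' [gz' cz'y]] := good_ex y cy.
rewrite (sP _ _ gz') (_ : z' = z)//.
by apply: (coord_inj cphi) => //; [case: gz'|rewrite cz'y].
Qed.

End LocalStructure.

(** * A global section of the orbit map *)

Section Sections.
Variables (R : realType) (n : nat) (M : small_cover_over_cube R n).
Local Notation Rn := 'rV[R]_n.
Local Notation to := (sc_action M).
Local Notation p := (@sc_orbit_map R n M).
Implicit Types (x y : M) (s t : Z2n n) (a b : Rn).

(** Codimension 0 means that no coordinate vanishes in a standard chart, and a
    sign change fixes only the vectors that vanish where it acts. *)
Lemma free_interior x t : cube_codim (p x) = 0%N -> to x t = x ->
  t = 0 :> 'rV_n.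
Proof.
have [c [phi [cphi cx]]] := standard_coordinates_at x.
rewrite (coord_codim cphi)// => /card0_eq c0 /(coord_stab _ cphi cx) tx.
apply: (@perm_inj _ phi); rewrite aut0; last exact: (coord_aut cphi).
by apply/rowP => i; rewrite mxE; apply: tx; have := c0 i; rewrite !inE => ->.
Qed.

(** The section is defined and continuous on the whole space, not only on the
    box: precomposing with [clamp a b] makes any section over the box so. *)
Definition has_section a b := exists s : Rn -> M,
  continuous s /\ forall v, box a b v -> p (s v) = v.

Definition nondegenerate a b :=
  forall j, [&& 0 <= a 0 j, a 0 j < b 0 j & b 0 j <= 1].

Definition set_coord (v : Rn) i (r : R) : Rn :=
  \row_j if j == i then r else v 0 j.

Lemma box_cube a b v : nondegenerate a b -> box a b v -> cube v.
Proof.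
by move=> ab vab j; have := ab j; have := vab j; lra.
Qed.

Lemma interior_codim (v : Rn) : (forall j, 0 < v 0 j < 1) -> cube_codim v = 0%N.
Proof.
move=> v01; apply: eq_card0 => j; rewrite !inE; have /andP[v0 v1] := v01 j.
by rewrite gt_eqF// lt_eqF.
Qed.

(** On the common face x_i = r the two sections differ by elements of the
    group. These are unique over the interior of the cube, hence constant along
    segments from the centre [v0] of the face. Translating the second section
    by the element found at [v0] makes both agree on the face, also on the part
    that lies in the boundary of the cube. *)
Lemma has_section_merge a b i r : nondegenerate a b -> a 0 i < r < b 0 i ->
  has_section a (set_coord b i r) -> has_section (set_coord a i r) b ->
  has_section a b.
Proof.
move=> ab air [s1 [s1c s1p]] [s2 [s2c s2p]].
have ab' j : a 0 j <= b 0 j by have := ab j; lra.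
have in1 v : box a b v -> v 0 i <= r -> box a (set_coord b i r) v.
  by move=> vab vi j; have := vab j; rewrite mxE; case: eqVneq => [->|_]; lra.
have in2 v : box a b v -> r <= v 0 i -> box (set_coord a i r) b v.
  by move=> vab vi j; have := vab j; rewrite mxE; case: eqVneq => [->|_]; lra.
pose v0 : Rn := \row_j if j == i then r else (a 0 j + b 0 j) / 2.
have v0ab : box a b v0.
  by move=> j; have := ab j; rewrite mxE; case: eqVneq => [->|_]; lra.
have v0i : v0 0 i = r by rewrite mxE eqxx.
have v0in j : 0 < v0 0 j < 1.
  by have := ab j; rewrite mxE; case: eqVneq => [->|_]; lra.
pose E (t : 'rV['F_2]_n) : set Rn := [set v | s1 v = to (s2 v) t].
have Ecl t : closed (E t).
  apply: (@closed_eq_continuous _ _ s1 (fun v => to (s2 v) t)) => //.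
    exact: sc_hausdorff.
  exact: comp_continuous s2c (@action_continuous _ _ M t).
have Eex v : box a b v -> v 0 i = r -> exists t, E t v.
  move=> vab vi; have : p (s2 v) = p (s1 v).
    rewrite s1p; last by apply: in1 => //; rewrite vi.
    by rewrite s2p//; apply: in2 => //; rewrite vi.
  by move=> /orbit_mapP[t] e; exists t.
have [t0 Et0] := Eex _ v0ab v0i.
have agree v : box a b v -> v 0 i = r -> s1 v = to (s2 v) t0.
  move=> vab vi; have segb q : 0 <= q < 1 -> box a b (segm v0 v q).
    move=> /andP[q0 q1] j; rewrite !mxE.
    by have := vab j; have := v0ab j; rewrite /v0 !mxE; nra.
  have segi q : segm v0 v q 0 i = r by rewrite !mxE eqxx vi; ring.
  have seg01 q : 0 <= q < 1 -> cube_codim (segm v0 v q) = 0%N.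
    move=> /andP[q0 q1]; apply: interior_codim => j.
    have := v0in j; have := box_cube ab vab j.
    have -> : segm v0 v q 0 j = (1 - q) * v0 0 j + q * v 0 j.
      by rewrite !mxE; ring.
    by nra.
  apply: (@closed_partition_segm _ _ _ E v0 v t0) => //.
    by move=> q q01; apply: Eex; rewrite ?segi//; exact: segb.
  move=> q t t' q01 /= e e'.
  have : to (s2 (segm v0 v q)) (t + t') = s2 (segm v0 v q).
    by rewrite actD -e e' actK_F2.
  move/free_interior => tt'; apply: (@addIr _ t'); rewrite F2_addvv; apply: tt'.
  rewrite s2p; first exact: seg01.
  by apply: in2; [exact: segb|rewrite segi].
exists (fun v => if clamp a b v 0 i <= r then s1 (clamp a b v)
                 else to (s2 (clamp a b v)) t0); split=> [|v vab].
  apply: continuous_glue.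
  - exact: comp_continuous (@continuous_clamp _ _ a b) s1c.
  - apply: (@comp_continuous _ _ _ (clamp a b) (to^~ t0 \o s2)).
      exact: continuous_clamp.
    exact: comp_continuous s2c (@action_continuous _ _ M t0).
  - apply: (@comp_continuous _ _ _ (clamp a b) (fun w : Rn => w 0 i)).
      exact: continuous_clamp.
    by move=> v; exact: coord_cvg.
  - by move=> v; apply: agree; exact: clamp_box.
rewrite clamp_id//; case: leP => vi; first by rewrite s1p//; exact: in1.
by rewrite orbit_map_act s2p//; apply: in2 => //; exact: ltW.
Qed.

Lemma cube_compact : compact (@cube R n).
Proof.
have [<- _ pc _ _] := sc_orbit_space M.
apply: continuous_compact (@sc_compact _ _ M).
exact: continuous_subspaceT.
Qed.

(** This is the Lebesgue number of the covering of the compact cube by the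
    domains of the local sections. The near-covering form of compactness is
    applied to the lower corner of the box. *)
Lemma has_section_small : exists2 d : R, 0 < d &
  forall a b, nondegenerate a b -> (forall j, b 0 j - a 0 j <= d) ->
    has_section a b.
Proof.
pose P (d : R) a := forall b, nondegenerate a b ->
  (forall j, b 0 j - a 0 j <= d) -> has_section a b.
have cov : near_covering (@cube R n).
  by apply/compact_near_coveringP; exact: cube_compact.
have nearP : \forall d \near 0^'+, @cube R n `<=` P d.
  apply: cov => v cv.
  have [B [s [oB Bv sp sc]]] := @local_section _ _ M v cv.
  have /nbhs_ballP[e /= e0 vB] : nbhs v B by exact: open_nbhs_nbhs.
  (* A box with sides at most e / 2 and lower corner in the ball of radius
     e / 2 lies in the ball of radius e. *)
  exists (ball v (e / 2), [set d | d < e / 2]) => /=.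
    split; first by apply: nbhsx_ballx; lra.
    by apply: nbhs_right_lt; lra.
  move=> [a d] [/= [_ va] de] b ab bad.
  have boxB w : box a b w -> B w.
    move=> wab; apply: vB; split=> // k j; rewrite (ord1 k).
    have := va 0 j; have := wab j; have := bad j; rewrite /ball/= !ltr_norml.
    lra.
  have boxab w : box a b (clamp a b w).
    by apply: clamp_box => j; have := ab j; lra.
  exists (s \o clamp a b); split=> [|w wab]; last first.
    by rewrite /= clamp_id// sp//; [exact: boxB|exact: box_cube ab wab].
  apply/continuousP => W oW; rewrite openE => w Ww; rewrite /interior/=.
  have [D [oD Dw DW]] :=
    sc W _ oW (boxB _ (boxab w)) (box_cube ab (boxab w)) Ww.
  have : nbhs w (clamp a b @^-1` D).
    by apply: continuous_clamp; exact: open_nbhs_nbhs.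
  apply: filterS => w' /= Dw'; apply: DW => //.
  exact: box_cube ab (boxab w').
have [d [d0 Pd]] := filter_ex (filterI (nbhs_right_gt (0 : R)) nearP).
exists d => // a b ab abd; apply: Pd => // j; have := ab j; have := ab j; lra.
Qed.

(** By induction on [k], for the boxes whose sides number k, k + 1, ... are
    small; side number k is halved until it is small too. *)
Lemma has_section_nondegenerate a b : nondegenerate a b -> has_section a b.
Proof.
have [d d0 sd] := has_section_small.
suff H k : (k <= n)%N -> forall a b, nondegenerate a b ->
    (forall j : 'I_n, (k <= j)%N -> b 0 j - a 0 j <= d) -> has_section a b.
  move=> ab; apply: (H n) => // j; by rewrite leqNgt ltn_ord.
elim: k => [_ {}a {}b ab abd|k IH kn]; first by apply: sd => // j; exact: abd.
pose i := Ordinal kn.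
suff {}H m : forall a b, nondegenerate a b -> b 0 i - a 0 i <= d * 2 ^+ m ->
    (forall j : 'I_n, (k < j)%N -> b 0 j - a 0 j <= d) -> has_section a b.
  (* The sides are at most 1, so m halvings are enough if 1/d <= 2 ^ m. *)
  move=> {}a {}b ab; apply: (H (Num.bound d^-1)) => //.
  have : d^-1 < 2 ^+ Num.bound d^-1.
    apply: lt_le_trans (archi_boundP _) _; first by rewrite invr_ge0 ltW.
    by rewrite -natrX ler_nat ltnW// ltn_expl.
  rewrite -(ltr_pM2l d0) divff ?gt_eqF//; have := ab i; lra.
elim: m => [|m IHm] {}a {}b ab abi abj.
  apply: IH => //; first exact: ltnW.
  move=> j; rewrite leq_eqVlt => /orP[/eqP kj|]; last exact: abj.
  by rewrite (_ : j = i) -1?[d]mulr1//; apply: val_inj.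
have abi' := ab i.
apply: (@has_section_merge _ _ i ((a 0 i + b 0 i) / 2)) => //; first by lra.
  apply: IHm.
  - by move=> j; have := ab j; rewrite mxE; case: eqVneq => [->|_]; lra.
  - by move: abi; rewrite mxE eqxx exprS; lra.
  - move=> j kj; rewrite mxE; case: eqVneq kj => [->|_]; last exact: abj.
    by rewrite ltnn.
apply: IHm.
- by move=> j; have := ab j; rewrite mxE; case: eqVneq => [->|_]; lra.
- by move: abi; rewrite mxE eqxx exprS; lra.
- move=> j kj; rewrite mxE; case: eqVneq kj => [->|_]; last exact: abj.
  by rewrite ltnn.
Qed.

Lemma exists_section :
  exists s : Rn -> M, continuous s /\ forall v, cube v -> p (s v) = v.
Proof.
have [|s [sc sp]] := @has_section_nondegenerate (const_mx 0) (const_mx 1).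
  by move=> j; rewrite !mxE; lra.
exists s; split=> // v cv; apply: sp => j; rewrite !mxE; exact: cv.
Qed.

End Sections.

(** * The characteristic function *)

Definition on_facet (R : realType) n (v : 'rV[R]_n) : pred 'I_n :=
  fun i => (v 0 i == 0) || (v 0 i == 1).

Lemma nbhs_on_facet (R : realType) n (v : 'rV[R]_n) :
  nbhs v [set w : 'rV[R]_n | forall i,
    (w 0 i = 0 -> v 0 i = 0) /\ (w 0 i = 1 -> v 0 i = 1)].
Proof.
have vF : Filter (nbhs v) by exact: nbhs_filter.
pose f i := [set w : 'rV[R]_n |
  (w 0 i = 0 -> v 0 i = 0) /\ (w 0 i = 1 -> v 0 i = 1)].
apply: (@filter_forall _ _ f (nbhs v)) => i.
have ne (r : R) : nbhs v [set w : 'rV[R]_n | w 0 i = r -> v 0 i = r].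
  have [->|/eqP vr] := eqVneq (v 0 i) r; first exact: filterE.
  have : nbhs (v 0 i) (~` [set r]).
    by apply: open_nbhs_nbhs; split => //; rewrite openC; exact: closed_eq.
  move/(@coord_cvg R n v i) => /= vw.
  by apply: (@filterS _ _ vF _ _ _ vw) => w /= wr /wr.
exact: filterI (ne 0) (ne 1).
Qed.

Section Characteristic.
Variables (R : realType) (n : nat) (M : small_cover_over_cube R n).
Local Notation Rn := 'rV[R]_n.
Local Notation to := (sc_action M).
Local Notation p := (@sc_orbit_map R n M).
Implicit Types (x y : M) (t : 'rV['F_2]_n) (v : Rn).

(** The group is abelian, so the isotropy group is constant along orbits. *)
Lemma stab_orbit x y t : p x = p y -> to x t = x -> to y t = y.
Proof.
by move=> /orbit_mapP[t' <-] xt; rewrite -actD addrC actD xt.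
Qed.

Lemma coord_stab1 c phi x j t : standard_coordinates c phi -> c.1 x ->
  (forall k, (c.2 x 0 k == 0) = (k == j)) ->
  to x t = x <-> t = 0 \/ t = (phi^-1)%g (delta_mx 0 j : 'rV_n).
Proof.
move=> cphi cx cxj; have phia := coord_aut cphi.
rewrite (coord_stab _ cphi cx); split=> [t0|[->|->]].
- have pt : phi t = (phi t : 'rV_n) 0 j *: delta_mx 0 j :> 'rV_n.
    apply/rowP => k; rewrite !mxE eqxx/=; case: eqVneq => [->|kj].
      by rewrite mulr1.
    by rewrite mulr0 t0// cxj.
  case: (F2_cases ((phi t : 'rV_n) 0 j)) => e;
    rewrite e ?scale0r ?scale1r in pt.
    by left; apply: (@perm_inj _ phi); rewrite pt aut0.
  by right; rewrite -pt permK.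
- by move=> i _; rewrite aut0// mxE.
- by move=> i; rewrite cxj permKV mxE => /negPf ->; rewrite andbF.
Qed.

Lemma codim1_stab x : cube_codim (p x) = 1%N ->
  exists t0 : 'rV['F_2]_n, t0 != 0 /\ forall t, to x t = x <-> t = 0 \/ t = t0.
Proof.
have [c [phi [cphi cx]]] := standard_coordinates_at x.
rewrite (coord_codim cphi)// => /mem_card1[j cj].
exists ((phi^-1)%g (delta_mx 0 j : 'rV_n)); split.
  apply/eqP => /(congr1 phi); rewrite permKV aut0; last exact: (coord_aut cphi).
  by move/rowP/(_ j); rewrite !mxE !eqxx.
by move=> t; apply: coord_stab1 cphi cx _ => k; have := cj k; rewrite !inE.
Qed.

Definition facet_center i (e : bool) : Rn :=
  \row_j if j == i then e%:R else 2^-1.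

Lemma facet_codim v i (e : bool) : v 0 i = e%:R ->
  (forall j, j != i -> 0 < v 0 j < 1) -> cube_codim v = 1%N.
Proof.
move=> vi vj; rewrite /cube_codim (eq_card (B := pred1 i)) ?card1// => j.
rewrite !inE; have [->|ji] := eqVneq j i.
  by rewrite vi; case: e {vi}; rewrite ?eqxx ?orbT.
by have /andP[v0 v1] := vj j ji; rewrite gt_eqF// lt_eqF.
Qed.

(** The vector is the generator of the isotropy group over the centre of the
    facet. It fixes the values of a section along the segment from the centre
    to any other point of the closed facet, since the isotropy groups over the
    interior of the facet have order 2 and being fixed by a given element is a
    closed condition. *)
Lemma facet_stab i (e : bool) :
  exists2 t : 'rV['F_2]_n, t != 0 &
    forall x, p x 0 i = e%:R -> to x t = x.
Proof.
have [s [sc sp]] := exists_section M.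
pose m := facet_center i e.
have mi : m 0 i = e%:R by rewrite mxE eqxx.
have mj j : j != i -> m 0 j = 2^-1 by move=> /negPf ji; rewrite mxE ji.
have e01 : 0 <= (e%:R : R) <= 1 by case: e {m mi mj}; rewrite /= ?lexx ?ler01.
have mc : cube m.
  by move=> j; have [->|/mj ->] := eqVneq j i; [rewrite mi|lra].
have mcod : cube_codim (p (s m)) = 1%N.
  by rewrite sp//; apply: facet_codim mi _ => j /mj ->; lra.
have [t0 [t00 t0P]] := codim1_stab mcod.
exists t0 => // x px.
pose E t := [set v | t != 0 /\ to (s v) t = s v].
suff [_] : E t0 (p x).
  by apply: stab_orbit; rewrite sp//; exact: cube_orbit_map.
have segc q : 0 <= q < 1 ->
    cube (segm m (p x) q) /\ cube_codim (segm m (p x) q) = 1%N.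
  move=> q01; have segE j : segm m (p x) q 0 j = (1 - q) * m 0 j + q * p x 0 j.
    by rewrite !mxE; ring.
  split=> [j|].
    by rewrite segE; have := mc j; have := cube_orbit_map x j; nra.
  apply: (@facet_codim _ i e) => [|j ji]; first by rewrite segE mi px; ring.
  by rewrite segE mj//; have := cube_orbit_map x j; nra.
apply: (@closed_partition_segm _ _ _ E m (p x) t0).
- move=> t; have [->|t1] := eqVneq t 0.
    rewrite (_ : E 0 = set0); first exact: closed0.
    by rewrite predeqE => v; split=> // -[]; rewrite eqxx.
  rewrite (_ : E t = [set v | to (s v) t = s v]).
    apply: (@closed_eq_continuous _ _ (fun v => to (s v) t) s) => //.
      exact: sc_hausdorff.
    exact: comp_continuous sc (@action_continuous _ _ M t).
  by rewrite predeqE => v; split=> [[]|].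
- move=> q /segc[qc qcod].
  have [|t [t1 tP]] := @codim1_stab (s (segm m (p x) q)); first by rewrite sp.
  by exists t; split=> //; apply/tP; right.
- move=> q t t' /segc[qc qcod] [t1 et] [t2 et'].
  have [|u [u1 uP]] := @codim1_stab (s (segm m (p x) q)); first by rewrite sp.
  move: et et' => /uP[t10|->]; first by rewrite t10 eqxx in t1.
  by move=> /uP[t20|->//]; rewrite t20 eqxx in t2.
- by split=> //; apply/t0P; right.
Qed.

(** Near [x] there are points [y] whose only vanishing coordinate is [j]. Such a
    [y] has an isotropy group of order 2 and lies over the interior of a facet,
    which contains the image of [x] if [y] is close enough to [x]. The two
    descriptions of the generator must agree. *)
Lemma coord_axis_facet (lam : 'I_n -> bool -> 'rV['F_2]_n) c phi x j :
  (forall i e, lam i e != 0) ->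
  (forall i (e : bool) y, p y 0 i = e%:R -> to y (lam i e) = y) ->
  standard_coordinates c phi -> c.1 x -> c.2 x 0 j = 0 ->
  exists2 i, on_facet (p x) i &
    (phi^-1)%g (delta_mx 0 j : 'rV_n) = lam i (p x 0 i == 1) :> 'rV_n.
Proof.
move=> lam0 lamP cphi cx cxj.
have := nbhs_on_facet (p x); set N := [set w | _] => nN.
pose W := c.1 `&` p @^-1` N°.
have oW : open W.
  apply: openI; first exact: (coord_open cphi).
  apply: open_comp; last exact: open_interior.
  by move=> y _; exact: orbit_map_continuous.
have : nbhs (c.2 x) (c.2 @` W).
  apply: open_nbhs_nbhs; split; last by exists x.
  by apply: (coord_open_map cphi) oW _ => y [].
move=> /nbhs_ballP[e /= e0 eW].
(* All the vanishing coordinates but j are moved away from 0. *)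
pose z : Rn := \row_k if (c.2 x 0 k == 0) && (k != j) then e / 2 else c.2 x 0 k.
have [|y [cy /interior_subset Ny] yz] := eW z.
  split=> // i k; rewrite (ord1 i) !mxE; case: ifP => [/andP[/eqP -> _]|_].
    by rewrite /ball/= sub0r normrN gtr0_norm; lra.
  exact: ballxx.
have cyj k : (c.2 y 0 k == 0) = (k == j).
  rewrite yz mxE; have [->|kj] := eqVneq k j; first by rewrite andbF cxj eqxx.
  by rewrite andbT; case: ifP => // _; rewrite gt_eqF//; lra.
have : cube_codim (p y) = 1%N.
  by rewrite (coord_codim cphi)// /corner_codim (eq_card (B := pred1 j)) ?card1.
move=> /mem_card1[i yi].
have /orP yfi : (p y 0 i == 0) || (p y 0 i == 1).
  by have := yi i; rewrite !inE eqxx.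
have [Ni0 Ni1] := Ny i.
have xfi : on_facet (p x) i.
  rewrite /on_facet; case: yfi => /eqP e1; first by rewrite Ni0 ?eqxx.
  by rewrite Ni1 ?eqxx ?orbT.
exists i => //.
have : to y (lam i (p x 0 i == 1)) = y.
  apply: lamP; case: yfi => /eqP e1; rewrite e1.
    by rewrite Ni0// eq_sym oner_eq0.
  by rewrite Ni1// eqxx.
move=> /(coord_stab1 _ cphi cy cyj)[lam00|->//].
by have := lam0 i (p x 0 i == 1); rewrite lam00 eqxx.
Qed.

(** [lam i e] belongs to the facet x_i = e of the cube: this says that [lam] is
    the characteristic function of [M]. The boolean [p x 0 i == 1] selects the
    facet when [i] is one of the facet coordinates; for the other [i] the
    coefficient is 0. *)
Definition spanned_stab (lam : 'I_n -> bool -> 'rV['F_2]_n) : Prop :=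
  forall x t, to x t = x <-> exists u : 'rV['F_2]_n,
    (forall i, ~~ on_facet (p x) i -> u 0 i = 0) /\
    t = \sum_i u 0 i *: lam i (p x 0 i == 1).

(** An element that fixes [x] is, up to the twist of a standard chart, a sum of
    coordinate vectors of vanishing coordinates, and each of these is the
    vector of a facet through the image of [x] ([coord_axis_facet]). Conversely
    the vectors of these facets fix [x] ([facet_stab]). *)
Lemma exists_characteristic_function : exists lam, spanned_stab lam.
Proof.
have /choice[lam lamP] : forall ie : 'I_n * bool, exists t : 'rV['F_2]_n,
    t != 0 /\ forall x, p x 0 ie.1 = ie.2%:R -> to x t = x.
  by move=> [i e]; have [t] := facet_stab i e; exists t.
exists (fun i e => lam (i, e)) => x t; split=> [xt|[u [u0 ->]]].
  have [c [phi [cphi cx]]] := standard_coordinates_at x.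
  have phia := coord_aut cphi.
  have /choice[g gP] : forall j, exists i, c.2 x 0 j = 0 -> on_facet (p x) i /\
      (phi^-1)%g (delta_mx 0 j : 'rV_n) = lam (i, p x 0 i == 1) :> 'rV_n.
    move=> j; have [cj|cj] := eqVneq (c.2 x 0 j) 0; last first.
      by exists j => /eqP; rewrite (negPf cj).
    have [||i xi e] :=
      @coord_axis_facet (fun i e => lam (i, e)) c phi x j _ _ cphi cx cj.
    - by move=> i e; case: (lamP (i, e)).
    - by move=> i e; case: (lamP (i, e)).
    by exists i.
  have pt0 j : c.2 x 0 j != 0 -> (phi t : 'rV_n) 0 j = 0.
    by move: j; apply/(coord_stab _ cphi cx).
  (* Several coordinates could a priori be sent by g to one facet, hence the
     sum. *)
  exists (\row_i \sum_(j | g j == i) (phi t : 'rV_n) 0 j); split=> [i xi|].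
    rewrite mxE big1// => j /eqP gj; apply: pt0; apply/eqP => /gP[+ _].
    by rewrite gj (negPf xi).
  have tE : t = \sum_j (phi t : 'rV_n) 0 j *:
      ((phi^-1)%g (delta_mx 0 j : 'rV_n) : 'rV_n).
    by rewrite -(aut_sum _ _ (autV phia)) -row_sum_delta permK.
  rewrite [LHS]tE (partition_big g xpredT)//=.
  apply: eq_bigr => i _; rewrite mxE scaler_suml; apply: eq_bigr => j /eqP gj.
  have [cj|cj] := eqVneq (c.2 x 0 j) 0; last by rewrite pt0// !scale0r.
  by have [_ ->] := gP _ cj; rewrite gj.
apply: (big_ind (fun t : 'rV_n => to x t = x)) => [|a b xa xb|i _].
- exact: act0.
- by rewrite actD xa.
case: (F2_cases (u 0 i)) => ui; rewrite ui ?scale0r ?scale1r; first exact: act0.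
have /orP xi : on_facet (p x) i.
  by apply/negPn/negP => /u0; rewrite ui => /eqP; rewrite oner_eq0.
apply: (lamP (i, _)).2 => /=.
by case: xi => /eqP ->; rewrite ?eqxx// eq_sym oner_eq0.
Qed.

(** The point over the vertex [eps] is fixed by the whole group, so the rows of
    this matrix span. *)
Lemma vertex_unit lam (eps : 'I_n -> bool) : spanned_stab lam ->
  (\matrix_i lam i (eps i)) \in unitmx.
Proof.
move=> lamP; pose v : Rn := \row_i (eps i)%:R.
have [|x px] := @orbit_map_surj _ _ M v.
  by move=> i; rewrite mxE; case: (eps i); rewrite ?lexx ?ler01.
rewrite -row_full_unit -sub1mx; apply/row_subP => i.
have : to x (row i 1%:M) = x.
  have [c [phi [cphi cx]]] := standard_coordinates_at x.
  apply/(coord_stab _ cphi cx) => k ck; exfalso.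
  have : corner_codim (c.2 x) = n.
    rewrite -(coord_codim cphi)// px /cube_codim -[RHS]card_ord.
    apply: eq_card => j.
    by rewrite !inE mxE; case: (eps j); rewrite eqxx ?orbT.
  rewrite -[RHS]card_ord => /subset_cardP/(_ (subset_predT _))/(_ k).
  by rewrite !inE (negPf ck).
move=> /lamP[u [_ ->]]; apply/submxP; exists u.
rewrite mulmx_sum_row; apply: eq_bigr => j _; rewrite rowK px mxE.
by case: (eps j); rewrite ?eqxx// eq_sym oner_eq0.
Qed.

End Characteristic.

(** * The acyclic digraph of a matrix with unit principal minors *)

Section Acyclic.
Variable n : nat.
Implicit Types (A : 'M['F_2]_n) (I : {set 'I_n}).

Definition mixed_rows A (eps : 'I_n -> bool) : 'M['F_2]_n :=
  \matrix_(i, j) if eps i then A i j else (i == j)%:R.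

(** The determinant of [mixed_rows A eps] is the principal minor of [A] on the
    support of [eps]. *)
Definition mixed_unit A := forall eps, mixed_rows A eps \in unitmx.

(** Otherwise the sum of the rows of [A] in [I] would be supported outside of
    [I]; adding unit rows there gives zero, a relation between the rows of
    [mixed_rows A] for the indicator function of [I]. *)
Lemma column_sum_neq0 A I : mixed_unit A -> I != finset.set0 ->
  exists2 j, j \in I & \sum_(i in I) A i j != 0.
Proof.
move=> Au /set0Pn[i0 Ii0].
suff /exists_inP[j Ij sj] : [exists j in I, \sum_(i in I) A i j != 0].
  by exists j.
apply: contraT => /exists_inPn A0.
pose w : 'rV['F_2]_n := \row_k if k \in I then 1 else \sum_(i in I) A i k.
have : w *m mixed_rows A (fun i => i \in I) = 0.
  apply/rowP => j; rewrite !mxE (bigID (fun i => i \in I))/=.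
  rewrite (eq_bigr (fun i => A i j)) => [|i Ii]; last by rewrite !mxE Ii mul1r.
  rewrite [X in _ + X](eq_bigr (fun i => if i == j then w 0 i else 0));
    last first => [i Ii|].
    by rewrite !mxE (negPf Ii); case: eqP; rewrite ?mulr1 ?mulr0.
  rewrite -big_mkcondr/=; have [Ij|Ij] := boolP (j \in I).
    have /negPn/eqP -> := A0 j Ij; rewrite big1 ?addr0// => i /andP[+ /eqP ij].
    by rewrite ij Ij.
  rewrite [X in _ + X](big_pred1 j) => [|i]; last first.
    by rewrite /= andbC; case: eqP => // ->.
  by rewrite mxE (negPf Ij) F2_addrr.
move/(congr1 (mulmx^~ (invmx (mixed_rows A (fun i => i \in I))))).
rewrite mul0mx mulmxK// => /rowP/(_ i0); rewrite !mxE Ii0 => /eqP.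
by rewrite oner_eq0.
Qed.

Lemma mixed_unit_diag A i : mixed_unit A -> A i i = 1.
Proof.
move=> Au; have [|j /set1P ->] := @column_sum_neq0 A [set i]%SET Au.
  by apply/set0Pn; exists i; rewrite finset.set11.
by rewrite big_set1; case: (F2_cases (A i i)) => ->; rewrite ?eqxx.
Qed.

Definition digraph_of A : digraph n :=
  [set e | (e.1 != e.2) && (A e.1 e.2 != 0)]%SET.

Lemma edgeE A i j : edge (digraph_of A) i j = (i != j) && (A i j != 0).
Proof. by rewrite /edge inE. Qed.

(** Otherwise consider a minimal nonempty set [J] in which every node has a
    successor, and choose successors [f]. Minimality makes [f] a permutation of
    [J], for every choice of [f], so that successors in [J] are unique. Then
    the column of any [j] in [J] has exactly two nonzero entries in the rows of
    [J], in the rows of [j] and of its predecessor, and their sum is zero. *)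
Lemma digraph_of_sink A I : mixed_unit A -> I != finset.set0 ->
  exists2 i, i \in I & forall j, j \in I -> ~~ edge (digraph_of A) i j.
Proof.
move=> Au I0; set e := edge _.
pose P (J : {set 'I_n}) :=
  (J != finset.set0) && [forall i in J, exists j in J, e i j].
suff nP : ~~ P I.
  move: nP; rewrite /P I0 => /forall_inPn[i Ii /exists_inPn nI].
  by exists i.
apply/negP => /minset_exists[J /minsetP[/andP[J0 /forall_inP PJ] Jmin] _].
have /fin_all_exists[f fP] : forall i, exists j, i \in J -> (j \in J) && e i j.
  move=> i; have [Ji|nJi] := boolP (i \in J); last by exists i.
  by have /exists_inP[j Jj ij] := PJ i Ji; exists j; rewrite Jj.
have image_succ g :
    (forall i, i \in J -> (g i \in J) && e i (g i)) -> g @: J = J.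
  move=> gP; have gJ : g @: J \subset J.
    by apply/fintype.subsetP => _ /imsetP[i Ji ->]; case/andP: (gP i Ji).
  apply: Jmin => //; apply/andP; split.
    have /set0Pn[i Ji] := J0; apply/set0Pn; exists (g i); exact: imset_f.
  apply/forall_inP => k kJ; have Jk := fintype.subsetP gJ k kJ.
  apply/exists_inP; exists (g k); first exact: imset_f.
  by case/andP: (gP k Jk).
have fJ := image_succ f fP.
have finj : {in J &, injective f} by apply/imset_injP; rewrite fJ.
have succ_uniq i k : i \in J -> k \in J -> e i k -> k = f i.
  move=> Ji Jk ik; apply/eqP/negPn/negP => kf.
  (* Redirecting i to k removes f i from the image, as f is injective. *)
  pose g l := if l == i then k else f l.
  have gJ : g @: J = J.
    apply: image_succ => l Jl; rewrite /g.
    case: eqVneq => [->|_]; last exact: fP.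
    by rewrite Jk.
  have /andP[Jfi _] := fP i Ji.
  move: Jfi; rewrite -{1}gJ => /imsetP[l Jl]; rewrite /g.
  case: eqVneq => [_ fik|li /(finj _ _ Ji Jl) il]; last first.
    by rewrite il eqxx in li.
  by rewrite fik eqxx in kf.
have [j Jj] := column_sum_neq0 Au J0; apply/negP/negPn/eqP.
have /imsetP[i Ji jf] : j \in f @: J by rewrite fJ.
have := fP i Ji; rewrite -jf /e edgeE => /and3P[_ ij Aij].
rewrite (bigD1 j)//= (bigD1 i)/=; last by rewrite Ji.
rewrite mixed_unit_diag// big1 => [|k /andP[/andP[Jk kj] ki]].
  by case: (F2_cases (A i j)) Aij => ->; rewrite ?eqxx// addr0 F2_addrr.
apply/eqP/negPn/negP => Akj; move/eqP: ki; apply; apply: finj => //.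
by rewrite -jf; apply/esym/succ_uniq => //; rewrite /e edgeE kj.
Qed.

(** A directed cycle has no sink. *)
Lemma digraph_of_acyclic A : mixed_unit A -> acyclic (digraph_of A).
Proof.
move=> Au c /andP[cc _]; case: c cc => // i0 c cc; exfalso.
have [|i] := @digraph_of_sink A [set i in i0 :: c]%SET Au.
  by apply/set0Pn; exists i0; rewrite inE mem_head.
rewrite inE => ic /(_ (next (i0 :: c) i)).
by rewrite inE mem_next ic (next_cycle cc ic) => /(_ isT).
Qed.

End Acyclic.

(** * Covers with isomorphic digraphs *)

Section Realization.
Variables (R : realType) (n : nat) (M1 M2 : small_cover_over_cube R n).
Local Notation Rn := 'rV[R]_n.
Local Notation p1 := (@sc_orbit_map R n M1).
Local Notation p2 := (@sc_orbit_map R n M2).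

(** Every point of [M1] is a translate of a point of the section [s1], and the
    assumption on isotropy groups makes the equivariant extension of
    s1 v |-> s2 v well defined. The preimage of a closed set is the union, over
    the group, of images of compact subsets of the cube, hence closed. *)
Lemma extend_along_section (s1 : Rn -> M1) (s2 : Rn -> M2)
    (phi : {perm Z2n n}) :
  is_Z2n_aut phi -> continuous s1 -> (forall v, cube v -> p1 (s1 v) = v) ->
  continuous s2 ->
  (forall v t, cube v -> sc_action M1 (s1 v) t = s1 v ->
    sc_action M2 (s2 v) (phi t) = s2 v) ->
  exists f : M1 -> M2, continuous f /\
    forall v t, cube v ->
      f (sc_action M1 (s1 v) t) = sc_action M2 (s2 v) (phi t).
Proof.
move=> phia s1c s1p s2c st.
have /choice[a aP] : forall x, exists t, sc_action M1 (s1 (p1 x)) t = x.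
  by move=> x; apply/orbit_mapP; rewrite s1p//; exact: cube_orbit_map.
pose f x := sc_action M2 (s2 (p1 x)) (phi (a x)).
have fE v t : cube v -> f (sc_action M1 (s1 v) t) = sc_action M2 (s2 v) (phi t).
  move=> cv; rewrite /f; set x := sc_action M1 (s1 v) t.
  have px : p1 x = v by rewrite orbit_map_act s1p.
  rewrite px; have := aP x; rewrite px {2}/x => e.
  have : sc_action M1 (s1 v) ((a x : 'rV_n) + t) = s1 v.
    by rewrite actD e actK_F2.
  move/(st _ _ cv); rewrite (Z2n_autP phi).1// actD => e2.
  by rewrite -{2}e2 actK_F2.
exists f; split=> //; apply/continuous_closedP => C Ccl.
rewrite (_ : f @^-1` C = \bigcup_(t in [set: Z2n n])
    ((fun v => sc_action M1 (s1 v) t) @`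
      (@cube R n `&` [set v | C (sc_action M2 (s2 v) (phi t))]))); last first.
  rewrite predeqE => x; split=> [Cfx|]; last first.
    by move=> [t _ [v [cv Cv] <-]]; rewrite /= fE.
  exists (a x) => //; exists (p1 x) => //.
  by split; [exact: cube_orbit_map|exact: Cfx].
apply: closed_bigcup; first exact: finite_finset.
move=> t _; apply: compact_closed; first exact: sc_hausdorff.
apply: continuous_compact.
  apply: continuous_subspaceT.
  exact: comp_continuous s1c (@action_continuous _ _ M1 t).
apply: compact_closedI; first exact: cube_compact.
apply: (@closed_comp _ _ (fun v => sc_action M2 (s2 v) (phi t)) C) => // v _.
exact: (comp_continuous s2c (@action_continuous _ _ M2 (phi t))).
Qed.

End Realization.

Section Classification.
Variables (R : realType) (n : nat).
Local Notation Rn := 'rV[R]_n.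
Local Notation cover := (small_cover_over_cube R n).
Implicit Types (M : cover) (lam : 'I_n -> bool -> 'rV['F_2]_n).

Lemma weakly_equiv_homeo_refl M : weakly_equiv_homeo M M.
Proof.
exists 1%g, id, id; split=> [||x t]; last by rewrite perm1.
  exact: group1.
by split=> // x; exact: cvg_id.
Qed.

Lemma weakly_equiv_homeo_sym M1 M2 :
  weakly_equiv_homeo M1 M2 -> weakly_equiv_homeo M2 M1.
Proof.
move=> [phi [f [g [phia [fc gc fK gK] fE]]]].
exists (phi^-1)%g, g, f; split=> //; first exact: autV.
by move=> x t; apply: (can_inj fK); rewrite fE !gK permKV.
Qed.

Lemma weakly_equiv_homeo_trans M1 M2 M3 : weakly_equiv_homeo M1 M2 ->
  weakly_equiv_homeo M2 M3 -> weakly_equiv_homeo M1 M3.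
Proof.
move=> [phi [f [g [phia [fc gc fK gK] fE]]]].
move=> [psi [f' [g' [psia [fc' gc' fK' gK'] fE']]]].
exists (phi * psi)%g, (f' \o f), (g \o g'); split.
- exact: groupM.
- split; [exact: comp_continuous fc fc'|exact: comp_continuous gc' gc| |];
    exact: can_comp.
- by move=> x t; rewrite /= fE fE' permM.
Qed.

Definition char_matrix lam (e : bool) : 'M['F_2]_n := \matrix_i lam i e.

(** The coordinates of the vectors [lam i true] in the basis of the vectors
    [lam i false], as rows. *)
Definition reduced_matrix lam : 'M['F_2]_n :=
  char_matrix lam true *m invmx (char_matrix lam false).

Lemma reduced_matrix_unit M lam : spanned_stab M lam ->
  mixed_unit (reduced_matrix lam).
Proof.
move=> lamP eps; have L0u := vertex_unit (fun=> false) lamP.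
rewrite (_ : mixed_rows _ _ =
    (\matrix_i lam i (eps i)) *m invmx (char_matrix lam false)).
  by rewrite unitmx_mul (vertex_unit eps lamP)/= unitmx_inv.
apply/row_matrixP => i; rewrite row_mul rowK; case ei : (eps i).
  by rewrite -[lam i true](rowK (fun i => lam i true)) -row_mul;
    apply/rowP => j; rewrite !mxE ei.
rewrite -[lam i false](rowK (fun i => lam i false)) -row_mul mulmxV//.
by apply/rowP => j; rewrite !mxE ei.
Qed.

Definition permute_coords (s : 'S_n) (v : Rn) : Rn := \row_i v 0 ((s^-1)%g i).

Lemma permute_coords_continuous s : continuous (permute_coords s).
Proof.
move=> v; apply: continuous_rV_at => i; rewrite mxE.
have -> : (fun w => permute_coords s w 0 i) = (fun w : Rn => w 0 ((s^-1)%g i)).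
  by apply/funext => w; rewrite mxE.
exact: coord_cvg.
Qed.

Lemma permute_coords_cube s v : cube v -> cube (permute_coords s v).
Proof. by move=> cv i; rewrite mxE; exact: cv. Qed.

Lemma permute_coordsK s : cancel (permute_coords s) (permute_coords s^-1%g).
Proof. by move=> v; apply/rowP => i; rewrite !mxE invgK permK. Qed.

Lemma stab_transport M1 M2 lam1 lam2 (s : 'S_n) (phi : {perm Z2n n}) :
  spanned_stab M1 lam1 -> spanned_stab M2 lam2 -> is_Z2n_aut phi ->
  (forall i e, phi (lam1 i e) = lam2 (s i) e :> 'rV_n) ->
  forall x1 x2 t,
    @sc_orbit_map _ _ M2 x2 = permute_coords s (@sc_orbit_map _ _ M1 x1) ->
    sc_action M1 x1 t = x1 -> sc_action M2 x2 (phi t) = x2.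
Proof.
move=> lam1P lam2P phia phil x1 x2 t px /lam1P[u [u0 ->]]; apply/lam2P.
exists (\row_i u 0 ((s^-1)%g i)); split=> [i|].
  by rewrite px /on_facet !mxE => /u0.
rewrite aut_sum// [RHS](reindex_inj (@perm_inj _ s)); apply: eq_bigr => i _.
by rewrite !mxE px !mxE permK phil.
Qed.

(** Permuting the coordinates of the cube carries the section of [M1] to that
    of [M2]; the inverse homeomorphism is built from the inverse permutation
    and the inverse automorphism. *)
Lemma weakly_equiv_of_characteristic M1 M2 lam1 lam2 (s : 'S_n)
    (phi : {perm Z2n n}) :
  spanned_stab M1 lam1 -> spanned_stab M2 lam2 -> is_Z2n_aut phi ->
  (forall i e, phi (lam1 i e) = lam2 (s i) e :> 'rV_n) ->
  weakly_equiv_homeo M1 M2.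
Proof.
move=> lam1P lam2P phia phil.
have [s1 [s1c s1p]] := exists_section M1.
have [s2 [s2c s2p]] := exists_section M2.
have hK := permute_coordsK s; have hK' := permute_coordsK s^-1%g.
rewrite invgK in hK'.
have [||f [fc fE]] := @extend_along_section _ _ M1 M2 s1
  (s2 \o permute_coords s) phi phia s1c s1p.
- exact: comp_continuous (@permute_coords_continuous s) s2c.
- move=> v t cv; apply: (stab_transport lam1P lam2P phia phil).
  by rewrite s2p ?s1p//; exact: permute_coords_cube.
have phil' i e : (phi^-1)%g (lam2 i e) = lam1 ((s^-1)%g i) e :> 'rV_n.
  by apply: (@perm_inj _ phi); rewrite permKV phil permKV.
have [||g [gc gE]] := @extend_along_section _ _ M2 M1 s2
  (s1 \o permute_coords s^-1%g) (phi^-1)%g (autV phia) s2c s2p.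
- exact: comp_continuous (@permute_coords_continuous s^-1%g) s1c.
- move=> v t cv; apply: (stab_transport lam2P lam1P (autV phia) phil').
  by rewrite s1p ?s2p//; exact: permute_coords_cube.
have dec1 x : exists v t, cube v /\ sc_action M1 (s1 v) t = x.
  have cx := cube_orbit_map x; exists (@sc_orbit_map _ _ M1 x).
  by have /orbit_mapP[t tx] := s1p _ cx; exists t.
have dec2 x : exists v t, cube v /\ sc_action M2 (s2 v) t = x.
  have cx := cube_orbit_map x; exists (@sc_orbit_map _ _ M2 x).
  by have /orbit_mapP[t tx] := s2p _ cx; exists t.
exists phi, f, g; split=> //.
  split=> // x.
    have [v [t [cv <-]]] := dec1 x.
    by rewrite fE// gE/= ?hK ?permK//; exact: permute_coords_cube.
  have [v [t [cv <-]]] := dec2 x.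
  by rewrite gE// fE/= ?hK' ?permKV//; exact: permute_coords_cube.
move=> x t; have [v [t' [cv <-]]] := dec1 x.
rewrite -actD !fE// (Z2n_autP phi).1//; exact: actD.
Qed.

(** The automorphism sends the basis lam1 i 0 to the basis lam2 (s i) 0. It then
    sends lam1 i 1 to lam2 (s i) 1 because [s] carries the coordinate matrix
    of [M1] to that of [M2]: the entries off the diagonal are the edges, and
    those on the diagonal are 1. *)
Lemma weakly_equiv_of_digraph_iso M1 M2 lam1 lam2 :
  spanned_stab M1 lam1 -> spanned_stab M2 lam2 ->
  digraph_iso (digraph_of (reduced_matrix lam1))
              (digraph_of (reduced_matrix lam2)) ->
  weakly_equiv_homeo M1 M2.
Proof.
move=> lam1P lam2P /existsP[s /eqP sE].
set A1 := reduced_matrix lam1 in sE; set A2 := reduced_matrix lam2 in sE.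
have A1u : mixed_unit A1 := reduced_matrix_unit lam1P.
have A2u : mixed_unit A2 := reduced_matrix_unit lam2P.
have AE i j : A2 (s i) (s j) = A1 i j.
  have [->|ij] := eqVneq i j; first by rewrite !mixed_unit_diag.
  have : edge (digraph_of A2) (s i) (s j) = edge (digraph_of A1) i j.
    rewrite /edge -sE; apply/imsetP/idP => [|ijE].
      by move=> [[k l] kl /= [/perm_inj-> /perm_inj->]].
    by exists (i, j).
  rewrite !edgeE (inj_eq perm_inj) ij/=.
  by have [->|->] := F2_cases (A2 (s i) (s j));
    have [->|->] := F2_cases (A1 i j).
pose L1 := char_matrix lam1 false; pose L2 := char_matrix lam2 false.
have L1u : L1 \in unitmx := vertex_unit (fun=> false) lam1P.
have L2u : L2 \in unitmx := vertex_unit (fun=> false) lam2P.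
pose B := invmx L1 *m row_perm s L2.
have Bu : B \in unitmx.
  by rewrite unitmx_mul unitmx_inv L1u row_permE unitmx_mul unitmx_perm L2u.
have Binj : injective (fun t : Z2n n => (t : 'rV_n) *m B : Z2n n).
  by move=> t t' /(congr1 (mulmx^~ (invmx B))); rewrite !mulmxK.
pose phi : {perm Z2n n} := perm Binj.
apply: (@weakly_equiv_of_characteristic _ _ lam1 lam2 s phi) => //.
  by apply/Z2n_autP => t t'; rewrite !permE mulmxDl.
move=> i e; rewrite permE.
have rowB k : row k (L1 *m B) = lam2 (s k) false.
  by rewrite mulmxA mulmxV// mul1mx; apply/rowP => j; rewrite !mxE.
have lamE lam k e' : lam k e' = row k (char_matrix lam e') by rewrite rowK.
case: e; last by rewrite lamE -row_mul rowB.
have L1E : char_matrix lam1 true = A1 *m L1 by rewrite mulmxKV.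
have L2E : char_matrix lam2 true = A2 *m L2 by rewrite mulmxKV.
rewrite lamE -row_mul L1E -mulmxA (lamE lam2) L2E row_mul [RHS]row_mul.
rewrite mulmx_sum_row [RHS]mulmx_sum_row [RHS](reindex_inj (@perm_inj _ s)).
by apply: eq_bigr => j _; rewrite rowB rowK; congr (_ *: _);
  rewrite [LHS]mxE [RHS]mxE AE.
Qed.

End Classification.

Lemma digraph_iso_refl n (E : digraph n) : digraph_iso E E.
Proof.
apply/existsP; exists 1%g; apply/eqP/setP => -[i j]; apply/imsetP/idP.
  by move=> [[k l] kl]; rewrite !perm1 => ->.
by move=> ij; exists (i, j); rewrite ?perm1.
Qed.

Theorem theorem4p1 (R : realType) (n : nat) (n_gt0 : (0 < n)%N) :
  exists2 N : nat, has_num_classes (@weakly_equiv_homeo R n) N &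
    (N <= num_unlabeled_acyclic_digraphs n)%N.
Proof.
have /choice[lam lamP] := @exists_characteristic_function R n.
pose D M := digraph_of (reduced_matrix (lam M)).
pose X := [set E : digraph n | `[< acyclic E >]]%SET.
have DX M : D M \in X.
  by rewrite inE; apply/asboolP/digraph_of_acyclic/reduced_matrix_unit/lamP.
apply: (@has_num_classes_le _ _ _ _
  (fun M => [set E in X | digraph_iso (D M) E]%SET)).
- exact: weakly_equiv_homeo_refl.
- exact: weakly_equiv_homeo_sym.
- exact: weakly_equiv_homeo_trans.
- by move=> M; exact: imset_f.
move=> M1 M2 sameF.
have : D M2 \in [set E in X | digraph_iso (D M2) E]%SET.
  by apply/setIdP; split; [exact: DX|exact: digraph_iso_refl].
by rewrite -sameF => /setIdP[_]; exact: weakly_equiv_of_digraph_iso.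
Qed.
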